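(* Let $p_1,p_3,p_5,p_7\in\mathbb{T}^2$ be any tropical points (repetitions allowed). For $i,j\in\{1,3,5,7\}$, $i\ne j$, let $\overline{ij}$ denote the stable tropical line through $p_i$ and $p_j$, and put $a=\overline{13}$, $b=\overline{15}$, $c=\overline{17}$, $d=\overline{35}$, $e=\overline{37}$, $f=\overline{57}$. Let $p_2$ be the stable intersection point of $a$ and $f$, $p_4$ that of $c$ and $d$, and $p_6$ that of $b$ and $e$. Then there is a tropical line $l$ containing $p_2$, $p_4$ and $p_6$.
   Context: $\mathbb{T}$, with $\mathbb{Q}\subseteq\mathbb{T}\subseteq\mathbb{R}$, is the value group of an algebraically closed field with a non-trivial rank one valuation (so a divisible subgroup of $\mathbb{R}$), with tropical operations $\max$ and $+$. A tropical line is the set of points $(x,y)\in\mathbb{T}^2$ at which $\max(\lambda+x,\mu+y,\nu)$ is attained at least twice, for some $\lambda,\mu,\nu\in\mathbb{T}$. The stable tropical line through (possibly equal) points $q=(q^1,q^2)$ and $r=(r^1,r^2)$ is the one given by tropical Cramer's rule: $\lambda=\max(q^2,r^2)$, $\mu=\max(q^1,r^1)$, $\nu=\max(q^1+r^2,q^2+r^1)$. The stable intersection point of the (possibly equal) lines with coefficients $(\lambda,\mu,\nu)$, $(\lambda',\mu',\nu')$ is $\bigl(\max(\mu+\nu',\mu'+\nu)-\max(\lambda+\mu',\lambda'+\mu),\ \max(\lambda+\nu',\lambda'+\nu)-\max(\lambda+\mu',\lambda'+\mu)\bigr)$; it is the point that varies continuously with the coefficients and coincides with the intersection point for transversal lines.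 *)

(* Defs.v *)
From mathcomp Require Import all_boot all_order all_algebra.
From mathcomp Require Import boolp classical_sets reals constructive_ereal.
Set Implicit Arguments.
Unset Strict Implicit.
Unset Printing Implicit Defensive.
Import Order.TTheory GRing.Theory Num.Theory.
Local Open Scope classical_set_scope.
Local Open Scope ring_scope.

(* Rank at most one is built in: the value group is a subgroup of the reals.
   Together with [valuation_nontrivial] the rank is exactly one. *)
Record rank_one_valuation (R : realType) (K : fieldType) := RankOneValuation {
  valuation :> K -> \bar R;
  valuation_pinfty : forall x, valuation x = +oo%E <-> x = 0;
  valuation_ninfty : forall x, valuation x <> -oo%E;
  valuationM : forall x y, valuation (x * y) = (valuation x + valuation y)%E;
  valuationD : forall x y,
    (Order.min (valuation x) (valuation y) <= valuation (x + y))%E;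
  valuation_nontrivial : exists x, x <> 0 /\ valuation x <> 0%E
}.

Definition value_group (R : realType) (K : fieldType)
    (v : rank_one_valuation R K) : set R :=
  [set r | exists x : K, v x = r%:E].

Section TropicalPlane.
Variable R : realType.
Implicit Types (T : set R) (p q r : R * R) (g h : R * R * R).

(* A triple (lambda, mu, nu) of coefficients stands for the tropical linear
   form max(lambda + x, mu + y, nu); stable intersection is computed from the
   coefficients and does not change when a constant is added to all three. *)

Definition line_points T g : set (R * R) :=
  let: (lambda, mu, nu) := g in
  [set p | [/\ T p.1, T p.2 &
    let terms := [:: lambda + p.1; mu + p.2; nu] in
    let m := Num.max (lambda + p.1) (Num.max (mu + p.2) nu) in
    (2 <= count_mem m terms)%N]].

Definition is_tropical_line T (l : set (R * R)) : Prop :=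
  exists lambda mu nu,
    [/\ T lambda, T mu, T nu & l = line_points T (lambda, mu, nu)].

Definition stable_line q r : R * R * R :=
  (Num.max q.2 r.2, Num.max q.1 r.1, Num.max (q.1 + r.2) (q.2 + r.1)).

Definition stable_intersection g h : R * R :=
  let: (lambda, mu, nu) := g in
  let: (lambda', mu', nu') := h in
  (Num.max (mu + nu') (mu' + nu) - Num.max (lambda + mu') (lambda' + mu),
   Num.max (lambda + nu') (lambda' + nu) -
     Num.max (lambda + mu') (lambda' + mu)).

End TropicalPlane.

(* Main.v *)
(* The Fano configuration: over a field of characteristic 2 the diagonal points of
   a complete quadrilateral are collinear. Lift the four points to points with
   indeterminate coordinates over F_2, the indeterminates being weighted by the
   given tropical coordinates. All monomials in the homogeneous coordinates of the
   lifted diagonal points are distinct, so these coordinates tropicalize to the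
   stable ones. Their 3x3 determinant vanishes, hence no term of the tropical
   determinant is strictly larger than all the others: such a term would have a
   leading monomial that nothing cancels. Tropical singularity of the matrix then
   puts one of the three points on the stable line through the other two. *)

Require Import Defs.
From mathcomp Require Import all_boot all_order all_algebra.
From mathcomp Require Import boolp classical_sets reals constructive_ereal.
From mathcomp Require Import ring lra.
Import Order.TTheory GRing.Theory Num.Theory.
Local Open Scope classical_set_scope.
Local Open Scope ring_scope.

(** * Polynomials over F_2 and the Fano identity *)

(* A monomial is the sorted word of its variables, where the letters 2i and 2i+1
   are the coordinates x and y of the i-th point. A polynomial is the list of its
   monomials with repetitions, so that over F_2 it vanishes when every monomial
   occurs an even number of times. *)
Definition monomial := seq nat.
Definition polynomial_f2 := seq monomial.

Definition mono_mul (m n : monomial) : monomial := sort leq (m ++ n).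

Definition poly_mul (A B : polynomial_f2) : polynomial_f2 :=
  [seq mono_mul m n | m <- A, n <- B].

Definition varx i : polynomial_f2 := [:: [:: i.*2]].
Definition vary i : polynomial_f2 := [:: [:: i.*2.+1]].

(** Cross product of the lifts [(x_i, y_i, 1)] and [(x_j, y_j, 1)]; signs vanish in characteristic
    2. *)
Definition line_poly i j : seq polynomial_f2 :=
  [:: vary i ++ vary j; varx i ++ varx j;
      poly_mul (varx i) (vary j) ++ poly_mul (vary i) (varx j)].

Definition meet_poly (g h : seq polynomial_f2) : seq polynomial_f2 :=
  let minor k l := poly_mul (nth [::] g k) (nth [::] h l) ++
                   poly_mul (nth [::] h k) (nth [::] g l) in
  [:: minor 1 2; minor 0 2; minor 0 1]%N.

(** Vertices 0, 1, 2, 3 stand for p1, p3, p5, p7, so that rows 0, 1, 2 lift p2, p4, p6. *)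
Definition diagonal_poly i j : polynomial_f2 := nth [::]
  (nth [::] [:: meet_poly (line_poly 0 1) (line_poly 2 3);
                meet_poly (line_poly 0 3) (line_poly 1 2);
                meet_poly (line_poly 0 2) (line_poly 1 3)] i) j.

Definition det_poly_term (s : seq nat) : polynomial_f2 :=
  poly_mul (poly_mul (diagonal_poly 0 (nth 0 s 0)) (diagonal_poly 1 (nth 0 s 1)))
    (diagonal_poly 2 (nth 0 s 2)).

Definition perms3 : seq (seq nat) := permutations (iota 0 3).

Fixpoint lex_leq (s t : seq nat) : bool :=
  match s, t with
  | x :: s', y :: t' => (x < y)%N || (x == y) && lex_leq s' t'
  | _, _ => true
  end.

Fixpoint paired (T : eqType) (s : seq T) : bool :=
  match s with
  | x :: y :: s' => (x == y) && paired T s'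
  | [::] => true
  | _ => false
  end.

Lemma paired_count (T : eqType) (s : seq T) a :
  paired T s -> ~~ odd (count a s).
Proof.
have [n] := ubnP (size s); elim: n s => // n IH [|x [|y s]] //= sz_s.
case/andP=> /eqP <- s_paired; rewrite addnA oddD addnn odd_double /=.
by apply: IH s_paired; rewrite ltnW.
Qed.

(* Over F_2 the diagonal points of a complete quadrilateral are collinear: their
   determinant is 2 times the product of four determinants of the vertices. *)
Lemma fano (m : monomial) :
  ~~ odd (count_mem m (flatten [seq det_poly_term s | s <- perms3])).
Proof.
(* Sorting is a permutation for any relation; it brings equal monomials together, so that the parity
   check becomes a linear scan. *)
rewrite -(permP (permEl (perm_sort lex_leq _))); apply: paired_count.
by vm_compute.
Qed.

(** One occurrence is odd while the total count is even, so some other term must contribute [m]. *)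
Lemma repeated_monomial s (m : monomial) : s \in perms3 ->
    count_mem m (det_poly_term s) = 1%N ->
  exists t, [/\ t \in perms3, t != s & m \in det_poly_term t].
Proof.
move=> s_in m1.
case: (boolP (has (fun t => m \in det_poly_term t) (rem s perms3))).
  case/hasP=> t; rewrite mem_rem_uniq ?permutations_uniq // => /andP[ts t_in] mt.
  by exists t.
move/hasPn=> no_m; have := fano m.
have/permP-> := perm_flatten (perm_map det_poly_term (perm_to_rem s_in)).
rewrite count_cat m1 oddD (_ : count_mem m _ = 0%N) //.
apply/count_memPn/flattenP => -[A /mapP[t t_in ->] mA].
by move: (no_m t t_in); rewrite mA.
Qed.

(** * Monomial order and leading monomials *)

Section Weights.
Variables (R : realType) (w : nat -> R).

Definition weight (m : monomial) : R := \sum_(i <- m) w i.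

(* Breaks the ties between weights. It separates the monomials of each
   [diagonal_poly], which are squarefree. *)
Definition code (m : monomial) : nat := sumn [seq 2 ^ i | i <- m]%N.

Definition mono_lt (m n : monomial) : bool :=
  (weight m < weight n) || (weight m == weight n) && (code m < code n)%N.

(** Strictness on [A'] forces [m] to occur exactly once, as the parity argument requires. *)
Definition leading (A : polynomial_f2) (m : monomial) :=
  exists2 A', perm_eq A (m :: A') & forall n, n \in A' -> mono_lt n m.

Lemma weight_mul m n : weight (mono_mul m n) = weight m + weight n.
Proof. by rewrite /weight (perm_big (m ++ n)) ?perm_sort //= big_cat. Qed.

Lemma code_mul m n : code (mono_mul m n) = (code m + code n)%N.
Proof.
rewrite -sumn_cat -map_cat; apply/perm_sumn/perm_map.
by rewrite perm_sort.
Qed.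

Lemma mono_lt_irr m : mono_lt m m = false.
Proof. by rewrite /mono_lt ltxx ltnn andbF. Qed.

Lemma mono_lt_trans : transitive mono_lt.
Proof.
move=> n m p /orP[mn|/andP[/eqP mn cmn]] /orP[np|/andP[/eqP np cnp]].
- by rewrite /mono_lt (lt_trans mn np).
- by rewrite /mono_lt -np mn.
- by rewrite /mono_lt mn np.
- by rewrite /mono_lt mn np eqxx (ltn_trans cmn cnp) orbT.
Qed.

Lemma mono_lt_mul2 m m' n n' :
  mono_lt m m' -> mono_lt n n' -> mono_lt (mono_mul m n) (mono_mul m' n').
Proof.
rewrite /mono_lt !weight_mul !code_mul.
move=> /orP[mm|/andP[/eqP-> cm]] /orP[nn|/andP[/eqP-> cn]].
- by rewrite ltrD.
- by rewrite ltrD2r mm.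
- by rewrite ltrD2l nn.
- by rewrite eqxx -addSn leq_add ?orbT // ltnW.
Qed.

Lemma mono_lt_mul2l p m n : mono_lt (mono_mul p m) (mono_mul p n) = mono_lt m n.
Proof.
by rewrite /mono_lt !weight_mul !code_mul ltrD2l (inj_eq (addrI _)) ltn_add2l.
Qed.

Lemma mono_lt_mul2r p m n : mono_lt (mono_mul m p) (mono_mul n p) = mono_lt m n.
Proof.
by rewrite /mono_lt !weight_mul !code_mul ltrD2r (inj_eq (addIr _)) ltn_add2r.
Qed.

(** Distinct codes make [mono_lt] total on the monomials of [A]. *)
Lemma leading_exists A : A != [::] -> uniq (map code A) -> exists m, leading A m.
Proof.
elim: A => //= m A IH _ /andP[m_notin /IH {}IH].
have [A0|/IH [n [A' pA ltA']]] := eqVneq A [::].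
  by exists m; exists [::] => //; rewrite A0.
have nA : n \in A by rewrite (perm_mem pA) mem_head.
have c_neq : code m != code n.
  by apply: contraNneq m_notin => ->; apply: map_f.
case: (boolP (mono_lt m n)) => [mn|not_mn].
  exists n; exists (m :: A').
    by rewrite perm_sym (perm_catCA [:: n] [:: m] A') perm_cons perm_sym.
  by move=> p; rewrite inE => /orP[/eqP->//|/ltA'].
have nm : mono_lt n m.
  move: not_mn; rewrite /mono_lt; case: ltgtP => //= _.
  by rewrite -leqNgt leq_eqVlt eq_sym (negbTE c_neq).
exists m; exists A => // p; rewrite (perm_mem pA) inE => /orP[/eqP->//|/ltA' pn].
exact: mono_lt_trans nm.
Qed.

(** Products need not be squarefree, so codes may collide there. Leading monomials still pass to
    products, because weight and code are both additive. *)
Lemma leading_mul A B m n :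
  leading A m -> leading B n -> leading (poly_mul A B) (mono_mul m n).
Proof.
move=> [A' pA ltA] [B' pB ltB].
exists ([seq mono_mul m y | y <- B'] ++ [seq mono_mul x y | x <- A', y <- n :: B']).
  exact: perm_allpairs pA pB.
move=> p; rewrite mem_cat => /orP[/mapP[y /ltB ? ->]|].
  by rewrite mono_lt_mul2l.
case/allpairsP=> -[x y] /= [/ltA xm]; rewrite inE => /orP[/eqP-> ->|/ltB yn ->].
  by rewrite mono_lt_mul2r.
exact: mono_lt_mul2.
Qed.

Lemma leading_count A m : leading A m -> count_mem m A = 1%N.
Proof.
case=> A' /permP-> ltA /=; rewrite eqxx; congr S.
by apply/count_memPn/negP => /ltA; rewrite mono_lt_irr.
Qed.

Lemma leading_weight A m n : leading A m -> n \in A -> weight n <= weight m.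
Proof.
case=> A' /perm_mem-> ltA; rewrite inE => /orP[/eqP->//|/ltA].
by case/orP=> [/ltW//|/andP[/eqP->]].
Qed.

(** * Tropicalization of polynomials *)

(** The maximum runs over the listed monomials before any cancellation over F_2, so sums go to [max]
    and products to [+] unconditionally. *)
Definition tropicalizes (A : polynomial_f2) (t : R) :=
  (exists2 m, m \in A & weight m = t) /\ forall m, m \in A -> weight m <= t.

Lemma tropicalizes_max A B s t :
  tropicalizes A s -> tropicalizes B t -> tropicalizes (A ++ B) (Num.max s t).
Proof.
move=> [[m mA <-] leA] [[n nB <-] leB]; split.
  case: (leP (weight m) (weight n)) => _.
    by exists n => //; rewrite mem_cat nB orbT.
  by exists m => //; rewrite mem_cat mA.
by move=> p; rewrite mem_cat le_max => /orP[/leA->//|/leB->]; rewrite orbT.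
Qed.

Lemma tropicalizes_add A B s t :
  tropicalizes A s -> tropicalizes B t -> tropicalizes (poly_mul A B) (s + t).
Proof.
move=> [[m mA <-] leA] [[n nB <-] leB]; split.
  by exists (mono_mul m n); [apply: allpairs_f | rewrite weight_mul].
by move=> _ /allpairsP[[x y] /= [/leA xs /leB yt ->]]; rewrite weight_mul lerD.
Qed.

Lemma tropicalizes_leading A m t : tropicalizes A t -> leading A m -> weight m = t.
Proof.
move=> [[n nA <-] leA] lead_m; apply/eqP; rewrite eq_le (leading_weight _ _ _ lead_m nA).
by rewrite leA // -has_pred1 has_count (leading_count _ _ lead_m).
Qed.

Lemma tropicalizes_var i : tropicalizes [:: [:: i]] (w i).
Proof.
have wi : weight [:: i] = w i by rewrite /weight big_seq1.
by split=> [|m]; [exists [:: i]; rewrite ?mem_head|rewrite inE => /eqP->; rewrite wi].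
Qed.

Lemma diagonal_poly_leading i j : (i < 3)%N -> (j < 3)%N ->
  exists m, leading (diagonal_poly i j) m.
Proof.
(* All nine coordinates are checked by computation, independently of the weights. *)
have : all (fun i => all (fun j => (diagonal_poly i j != [::]) &&
  uniq (map code (diagonal_poly i j))) (iota 0 3)) (iota 0 3) by vm_compute.
move=> /allP dP i3 j3; have /dP/allP dPi : i \in iota 0 3 by rewrite mem_iota.
have /dPi/andP[] : j \in iota 0 3 by rewrite mem_iota.
exact: leading_exists.
Qed.

Definition det_term (M : nat -> nat -> R) (s : seq nat) : R :=
  M 0 (nth 0 s 0) + M 1 (nth 0 s 1) + M 2 (nth 0 s 2).

Lemma tropical_fano (M : nat -> nat -> R) :
    (forall i j, (i < 3)%N -> (j < 3)%N -> tropicalizes (diagonal_poly i j) (M i j)) ->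
  forall s, s \in perms3 ->
    exists t, [/\ t \in perms3, t != s & det_term M s <= det_term M t].
Proof.
move=> trM.
have lt3 s k : s \in perms3 -> (k < 3)%N -> (nth 0 s k < 3)%N.
  rewrite mem_permutations => ps k3.
  have : nth 0 s k \in s by rewrite mem_nth // (perm_size ps).
  by rewrite (perm_mem ps) mem_iota.
have trD s : s \in perms3 -> tropicalizes (det_poly_term s) (det_term M s).
  by move=> s_in; do !apply: tropicalizes_add; apply: trM; rewrite ?lt3.
move=> s s_in.
have [m0 lead0] := diagonal_poly_leading 0 (nth 0 s 0) isT (lt3 s 0%N s_in isT).
have [m1 lead1] := diagonal_poly_leading 1 (nth 0 s 1) isT (lt3 s 1%N s_in isT).
have [m2 lead2] := diagonal_poly_leading 2 (nth 0 s 2) isT (lt3 s 2%N s_in isT).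
have lead := leading_mul _ _ _ _ (leading_mul _ _ _ _ lead0 lead1) lead2.
have [t [t_in ts mt]] := repeated_monomial s _ s_in (leading_count _ _ lead).
exists t; split=> //; rewrite -(tropicalizes_leading _ _ _ (trD _ s_in) lead).
by case: (trD _ t_in) => _; apply.
Qed.

End Weights.

(** * Lifts of the four points and of their diagonal points *)

Section Tropicalization.
Variables (R : realType) (P : nat -> R * R).

Definition coord (i : nat) : R := if odd i then (P i./2).2 else (P i./2).1.

Lemma tropicalizes_varx i : tropicalizes R coord (varx i) (P i).1.
Proof.
have := tropicalizes_var R coord i.*2.
by rewrite /coord odd_double doubleK.
Qed.

Lemma tropicalizes_vary i : tropicalizes R coord (vary i) (P i).2.
Proof.
have := tropicalizes_var R coord i.*2.+1.
by rewrite /coord /= odd_double /= uphalf_double.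
Qed.

Definition coefs (g : R * R * R) : seq R := [:: g.1.1; g.1.2; g.2].

(** Tropical cross product: the stable intersection before its third coordinate is subtracted. *)
Definition homogeneous_meet (g h : seq R) : seq R :=
  let minor k l := Num.max (nth 0 g k + nth 0 h l) (nth 0 h k + nth 0 g l) in
  [:: minor 1 2; minor 0 2; minor 0 1]%N.

Lemma stable_intersectionE (g h : R * R * R) :
  let H := nth 0 (homogeneous_meet (coefs g) (coefs h)) in
  stable_intersection g h = (H 0%N - H 2%N, H 1%N - H 2%N).
Proof. by case: g h => [[? ?] ?] [[? ?] ?]. Qed.

Lemma tropicalizes_line i j k : (k < 3)%N ->
  tropicalizes R coord (nth [::] (line_poly i j) k)
    (nth 0 (coefs (stable_line (P i) (P j))) k).
Proof.
have trx := tropicalizes_varx; have try := tropicalizes_vary.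
have add := tropicalizes_add R coord; have max := tropicalizes_max R coord.
case: k => [|[|[|]]] // _.
- exact: (max _ _ _ _ (try i) (try j)).
- exact: (max _ _ _ _ (trx i) (trx j)).
- exact: (max _ _ _ _ (add _ _ _ _ (trx i) (try j)) (add _ _ _ _ (try i) (trx j))).
Qed.

Lemma tropicalizes_meet gp hp g h :
    (forall k, (k < 3)%N -> tropicalizes R coord (nth [::] gp k) (nth 0 g k)) ->
    (forall k, (k < 3)%N -> tropicalizes R coord (nth [::] hp k) (nth 0 h k)) ->
  forall k, (k < 3)%N -> tropicalizes R coord (nth [::] (meet_poly gp hp) k)
    (nth 0 (homogeneous_meet g h) k).
Proof.
move=> trg trh [|[|[|]]] // _;
  by apply: (tropicalizes_max R coord (poly_mul _ _) (poly_mul _ _));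
    apply: tropicalizes_add; by [apply: trg|apply: trh].
Qed.

Definition diagonal_point (i : nat) : seq R :=
  let meet a b c d := homogeneous_meet (coefs (stable_line (P a) (P b)))
    (coefs (stable_line (P c) (P d))) in
  nth [::] [:: meet 0 1 2 3; meet 0 3 1 2; meet 0 2 1 3]%N i.

Lemma tropicalizes_diagonal i j : (i < 3)%N -> (j < 3)%N ->
  tropicalizes R coord (diagonal_poly i j) (nth 0 (diagonal_point i) j).
Proof.
by case: i => [|[|[|]]] // _ j3; apply: tropicalizes_meet => // k k3;
  apply: tropicalizes_line.
Qed.

End Tropicalization.

(** * Tropical lines and singular 3x3 matrices *)

Section Collinearity.
Variables (R : realType) (T : set R).
Hypotheses (TD : forall x y, T x -> T y -> T (x + y)) (TN : forall x, T x -> T (- x)).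

Let Tmax x y : T x -> T y -> T (Num.max x y).
Proof. by case: leP. Qed.

Lemma stable_intersection_closed (g h : R * R * R) :
    [/\ T g.1.1, T g.1.2 & T g.2] -> [/\ T h.1.1, T h.1.2 & T h.2] ->
  T (stable_intersection g h).1 /\ T (stable_intersection g h).2.
Proof.
case: g h => [[gl gm] gn] [[hl hm] hn] /= [? ? ?] [? ? ?].
by split; apply: TD; try apply: TN; apply: Tmax; apply: TD.
Qed.

Lemma stable_line_closed (q r : R * R) : T q.1 /\ T q.2 -> T r.1 /\ T r.2 ->
  let g := stable_line q r in [/\ T g.1.1, T g.1.2 & T g.2].
Proof. by move=> [? ?] [? ?]; split; apply: Tmax => //; apply: TD. Qed.

(** Here [z] is the value of the maximum; bounding it from both sides leaves only linear
    inequalities to check. *)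
Lemma mem_line_points (g : R * R * R) (p : R * R) z :
    T p.1 -> T p.2 -> g.1.1 + p.1 <= z -> g.1.2 + p.2 <= z -> g.2 <= z ->
    [|| (z <= g.1.1 + p.1) && (z <= g.1.2 + p.2),
        (z <= g.1.1 + p.1) && (z <= g.2) | (z <= g.1.2 + p.2) && (z <= g.2)] ->
  line_points T g p.
Proof.
case: g => [[l m] n] /= Tp1 Tp2 lz mz nz attained; split=> //=.
have -> : Num.max (l + p.1) (Num.max (m + p.2) n) = z.
  apply/eqP; rewrite eq_le !ge_max lz mz nz /= !le_max.
  by case/or3P: attained => /andP[-> ->]; rewrite ?orbT.
by rewrite !eq_le lz mz nz; case/or3P: attained => /andP[-> ->] /=;
  rewrite ?addn0 // ?addn1; case: (_ <= _).
Qed.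

Local Ltac attained_twice z :=
  apply: (mem_line_points _ _ z) => //=; try lra;
  apply/or3P; first [apply: Or31; lra | apply: Or32; lra | apply: Or33; lra].

(** At [q] each of [q.1 + q.2], [q.1 + r.2], [q.2 + r.1] occurs in two of the three terms of the
    form, so the largest of them is attained twice. *)
Lemma stable_line_l (q r : R * R) :
  T q.1 -> T q.2 -> line_points T (stable_line q r) q.
Proof.
move=> Tq1 Tq2; rewrite /stable_line.
by case: (leP q.1 r.1) => ?; case: (leP q.2 r.2) => ?;
  case: (leP (q.1 + r.2) (q.2 + r.1)) => ?;
  first [attained_twice (q.1 + q.2) | attained_twice (q.1 + r.2)
        | attained_twice (q.2 + r.1)].
Qed.

Lemma stable_lineC (q r : R * R) : stable_line q r = stable_line r q.
Proof.
by rewrite /stable_line maxC (maxC q.1) (maxC (q.1 + _)) (addrC q.1) (addrC q.2).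
Qed.

Lemma stable_line_r (q r : R * R) :
  T r.1 -> T r.2 -> line_points T (stable_line q r) r.
Proof. by rewrite stable_lineC; apply: stable_line_l. Qed.


(** The six sums are the terms of the tropical determinant with rows [(q, 0)], [(r, 0)], [(p, 0)].
    Expanding along the row of [p] groups them into the three terms of the stable line at [p]. *)
Lemma third_on_stable_line (q r p : R * R) z : T p.1 /\ T p.2 ->
    p.1 + q.2 <= z -> p.1 + r.2 <= z -> q.1 + p.2 <= z -> r.1 + p.2 <= z ->
    q.1 + r.2 <= z -> r.1 + q.2 <= z ->
    let x_max := (z <= p.1 + q.2) || (z <= p.1 + r.2) in
    let y_max := (z <= q.1 + p.2) || (z <= r.1 + p.2) in
    let n_max := (z <= q.1 + r.2) || (z <= r.1 + q.2) in
    [|| x_max && y_max, x_max && n_max | y_max && n_max] ->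
  line_points T (stable_line q r) p.
Proof.
move=> [Tp1 Tp2] h1 h2 h3 h4 h5 h6 x_max y_max n_max attained.
apply: (mem_line_points (stable_line q r) p z) => //=;
  rewrite ?addr_maxl ?ge_max ?le_max ?(addrC q.2) ?(addrC r.2);
  by rewrite ?h1 ?h2 ?h3 ?h4 ?h5 ?h6.
Qed.

Lemma exists_max (I : eqType) (f : I -> R) (s0 : I) (s : seq I) :
  exists2 i, i \in s0 :: s & forall j, j \in s0 :: s -> f j <= f i.
Proof.
elim: s s0 => [|s1 s IH] s0.
  by exists s0; rewrite ?mem_head // => j; rewrite inE => /eqP->.
have [i i_in le_i] := IH s1; case: (leP (f s0) (f i)) => [s0i|is0].
  by exists i => [|j]; rewrite inE ?i_in ?orbT // => /orP[/eqP->|/le_i].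
exists s0; rewrite ?mem_head // => j; rewrite inE => /orP[/eqP->//|/le_i ji].
exact: le_trans ji (ltW is0).
Qed.

(* Two distinct permutations attaining the maximum differ at some index k. As
   det_term is linear in row k, the point k then lies on the stable line through
   the other two. *)
Lemma singular_collinear (M : nat -> nat -> R) (q r p : R * R) :
    T q.1 /\ T q.2 -> T r.1 /\ T r.2 -> T p.1 /\ T p.2 ->
    q = (M 0 0 - M 0 2, M 0 1 - M 0 2) ->
    r = (M 1 0 - M 1 2, M 1 1 - M 1 2) ->
    p = (M 2 0 - M 2 2, M 2 1 - M 2 2) ->
    (forall s, s \in perms3 ->
      exists t, [/\ t \in perms3, t != s & det_term R M s <= det_term R M t]) ->
  exists l, [/\ is_tropical_line T l, l q, l r & l p].
Proof.
move=> Tq Tr Tp qE rE pE singular.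
have tropical u v : T u.1 /\ T u.2 -> T v.1 /\ T v.2 ->
    is_tropical_line T (line_points T (stable_line u v)).
  move=> Tu Tv; have [? ? ?] := stable_line_closed u v Tu Tv.
  by exists (stable_line u v).1.1, (stable_line u v).1.2, (stable_line u v).2.
suff : [\/ line_points T (stable_line q r) p,
    line_points T (stable_line q p) r | line_points T (stable_line r p) q].
  case: (Tq) (Tr) (Tp) => [? ?] [? ?] [? ?].
  case=> [on_qr|on_qp|on_rp];
    [exists (line_points T (stable_line q r))|exists (line_points T (stable_line q p))
    |exists (line_points T (stable_line r p))];
    split=> //; (exact: tropical || exact: stable_line_l || exact: stable_line_r).
(* Determinant terms after subtracting from each row its last entry, listed in the order in which
   [permutations] enumerates. *)
pose d u := nth 0 [:: r.1 + q.2; q.1 + r.2; r.1 + p.2; q.1 + p.2; p.1 + q.2; p.1 + r.2]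
  (index u perms3).
have dE u : u \in perms3 -> det_term R M u = d u + (M 0 2 + M 1 2 + M 2 2).
  rewrite !inE => /or4P[/eqP->|/eqP->|/eqP->|/or3P[/eqP->|/eqP->|/eqP->]];
    by rewrite /d qE rE pE /det_term /=; ring.
have {singular}[s [t [s_in t_in ts st max_s]]] : exists s t,
    [/\ s \in perms3, t \in perms3, t != s, d s <= d t &
        forall u, u \in perms3 -> d u <= d s].
  have [s s_in max_s] : exists2 s, s \in perms3 &
      forall u, u \in perms3 -> det_term R M u <= det_term R M s.
    exact: exists_max.
  have [t [t_in ts st]] := singular s s_in.
  exists s, t; split=> // [|u u_in]; last by have := max_s u u_in; rewrite !dE // lerD2r.
  by move: st; rewrite !dE // lerD2r.
(* An abstract name for the maximum makes [s] and [t] play symmetric roles in the case analysis. *)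
have [z [zs zt max_z]] : exists z, [/\ z <= d s, z <= d t &
    forall u, u \in perms3 -> d u <= z] by exists (d s).
have h012 : q.1 + r.2 <= z by exact: (max_z [:: 0; 1; 2]%N).
have h021 : q.1 + p.2 <= z by exact: (max_z [:: 0; 2; 1]%N).
have h102 : r.1 + q.2 <= z by exact: (max_z [:: 1; 0; 2]%N).
have h120 : p.1 + q.2 <= z by exact: (max_z [:: 1; 2; 0]%N).
have h201 : r.1 + p.2 <= z by exact: (max_z [:: 2; 0; 1]%N).
have h210 : p.1 + r.2 <= z by exact: (max_z [:: 2; 1; 0]%N).
have on_qr := third_on_stable_line q r p z Tp h120 h210 h021 h201 h012 h102.
have on_qp := third_on_stable_line q p r z Tr h102 h201 h012 h210 h021 h120.
have on_rp := third_on_stable_line r p q z Tq h012 h021 h102 h120 h201 h210.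
move: s_in t_in ts zs zt; rewrite !inE.
by move=> /or4P[/eqP->|/eqP->|/eqP->|/or3P[/eqP->|/eqP->|/eqP->]]
  /or4P[/eqP->|/eqP->|/eqP->|/or3P[/eqP->|/eqP->|/eqP->]] // _ /= zs zt;
  first [by apply/Or31/on_qr; rewrite zs zt ?orbT
        |by apply/Or32/on_qp; rewrite zs zt ?orbT
        |by apply/Or33/on_rp; rewrite zs zt ?orbT].
Qed.

End Collinearity.

(** * The value group is a subgroup of the reals *)

Section ValueGroup.
Variables (R : realType) (K : fieldType) (v : rank_one_valuation R K).

Lemma value_group_add (x y : R) :
  value_group v x -> value_group v y -> value_group v (x + y).
Proof. by move=> [a va] [b vb]; exists (a * b); rewrite valuationM va vb. Qed.

Lemma value_group_opp (x : R) : value_group v x -> value_group v (- x).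
Proof.
move=> [a va].
have a_neq0 : a != 0 by apply/eqP => /(valuation_pinfty v); rewrite va.
have fin b : b != 0 -> exists r, v b = r%:E.
  move=> b_neq0; case vb : (v b) => [r||]; first by exists r.
    by move/(valuation_pinfty v): vb b_neq0 => ->; rewrite eqxx.
  by case: (valuation_ninfty vb).
have [u v1] := fin 1 (oner_neq0 K).
have [y vy] := fin a^-1 (invr_neq0 a_neq0).
(* From [v 1 = v 1 + v 1], where finiteness of [v 1] allows cancellation. *)
have u0 : u = 0.
  have := valuationM v 1 1; rewrite mulr1 v1 -EFinD => -[] uu; lra.
have := valuationM v a a^-1; rewrite divff // v1 va vy -EFinD => -[] xy.
by exists a^-1; rewrite vy; congr EFin; lra.
Qed.

End ValueGroup.

Theorem theorem45 (R : realType) (K : closedFieldType)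
    (v : rank_one_valuation R K) (T : set R)
    (hT : T = value_group v) (hQT : forall q : rat, T (ratr q))
    (p1 p3 p5 p7 : R * R)
    (hp1 : T p1.1 /\ T p1.2) (hp3 : T p3.1 /\ T p3.2)
    (hp5 : T p5.1 /\ T p5.2) (hp7 : T p7.1 /\ T p7.2) :
  let a := stable_line p1 p3 in
  let b := stable_line p1 p5 in
  let c := stable_line p1 p7 in
  let d := stable_line p3 p5 in
  let e := stable_line p3 p7 in
  let f := stable_line p5 p7 in
  let p2 := stable_intersection a f in
  let p4 := stable_intersection c d in
  let p6 := stable_intersection b e in
  exists l : set (R * R),
    [/\ is_tropical_line T l, l p2, l p4 & l p6].
Proof.
move=> a b c d e f p2 p4 p6.
have TD (x y : R) : T x -> T y -> T (x + y) by rewrite hT; apply: value_group_add.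
have TN (x : R) : T x -> T (- x) by rewrite hT; apply: value_group_opp.
pose P := nth (0, 0) [:: p1; p3; p5; p7].
pose M i := nth 0 (diagonal_point R P i).
have closed i j k l : (forall n, T (P n).1 /\ T (P n).2) ->
    let p := stable_intersection (stable_line (P i) (P j)) (stable_line (P k) (P l)) in
    T p.1 /\ T p.2.
  move=> TP; apply: (stable_intersection_closed _ _ TD TN);
    exact: (stable_line_closed _ _ TD).
have TP n : T (P n).1 /\ T (P n).2.
  (* Indices above 3 yield the default point [(0, 0)], whose coordinates must lie in [T] too. *)
  have T0 : T 0 by have := hQT 0; rewrite rmorph0.
  by case: n => [|[|[|[|n]]]] //; rewrite /P /= nth_nil.
apply: (singular_collinear _ _ TD M p2 p4 p6).
- exact: (closed 0 1 2 3)%N.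
- exact: (closed 0 3 1 2)%N.
- exact: (closed 0 2 1 3)%N.
- exact: stable_intersectionE.
- exact: stable_intersectionE.
- exact: stable_intersectionE.
- exact: (tropical_fano _ _ _ (tropicalizes_diagonal R P)).
Qed.
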